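(* Let $\mathcal{C}$ be a category with functorial multiplication $\otimes:\mathcal{C}^2\rightarrow\mathcal{C}$. Let $\alpha$ be a natural isomorphism from $A\otimes(B\otimes C)$ to $(A\otimes B)\otimes C$ (as functors $\mathcal{C}^3\to\mathcal{C}$). If $E$ and $F$ are two expressions in $n-1$ appearances of $\otimes$ and $n$ different variables in the same order that differ only in the arrangement of parentheses, then there exists a unique natural isomorphism from $E$ to $F$ (that is, from the functor $\mathcal{C}^n\to\mathcal{C}$ represented by $E$ to the functor represented by $F$) constructable from $\alpha$ as a composition of instances of iterated right stabilizations of $\alpha$ and $\alpha^{-1}$.
   Context: A category with functorial multiplication is a category $\mathcal{C}$ together with a functor $\otimes:\mathcal{C}^2=\mathcal{C}\times\mathcal{C}\to\mathcal{C}$. No coherence condition (such as commutativity of the pentagon) is assumed on $\alpha$. Expressions. An expression in $n\ge 1$ variables is a fully parenthesized formal product of the variables $X_1,\dots,X_n$, in that order, with $n-1$ appearances of $\otimes$. Inductively: the variable $X_1$ is the only expression in $1$ variable, and if $P$, $Q$ are expressions in $m$, $k$ variables then $(P\otimes Q)$ is an expression in $m+k$ variables, where the subscripts of the variables of $Q$ are raised by $m$. Expressions are treated formally (as parenthesized words), but each expression in $n$ variables represents a functor $\mathcal{C}^n\to\mathcal{C}$. Iterated right stabilizations. Let $\mathbf{1}$ be the identity transformation of the identity functor of $\mathcal{C}$. For a natural transformation $\beta$ between functors $\mathcal{C}^m\to\mathcal{C}$, its right stabilization $\beta\otimes\mathbf{1}$ is the natural transformation between functors $\mathcal{C}^{m+1}\to\mathcal{C}$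 with components $(\beta\otimes\mathbf{1})_{(A_1,\dots,A_m,D)}=\beta_{(A_1,\dots,A_m)}\otimes \mathrm{id}_D$. Put $\alpha_0=\alpha$ and $\alpha_i=\alpha_{i-1}\otimes\mathbf{1}$ for $i\ge 1$; the $\alpha_i$ are the iterated right stabilizations of $\alpha$. Thus $\alpha_i$ is a natural isomorphism between functors $\mathcal{C}^{i+3}\to\mathcal{C}$, from $$(\cdots((X_1\otimes(X_2\otimes X_3))\otimes X_4)\otimes\cdots)\otimes X_{i+3}\quad\text{to}\quad(\cdots(((X_1\otimes X_2)\otimes X_3)\otimes X_4)\otimes\cdots)\otimes X_{i+3}.$$ The iterated right stabilizations of $\alpha^{-1}$ are defined likewise and are the inverses $\alpha_i^{-1}$. Instances. An instance of $\alpha_i$ (or $\alpha_i^{-1}$) is obtained by substituting for each of its $i+3$ variables, identically in source and target, an arbitrary expression (renumbering variables so that they appear in order $X_1,\dots,X_n$); that is, by precomposing the transformation with the functor $\mathcal{C}^n\to\mathcal{C}^{i+3}$ determined by $i+3$ expressions with $n$ variables in total. Its source and target are thereby expressions in $n$ variables. Compositions. A composition of instances from $E$ to $F$ is the composite of natural isomorphisms along a finite sequence (path) of expressions $E=E_0,E_1,\dots,E_s=F$ in $n$ variables, $s\ge 0$, in which each step $E_{t-1}\to E_t$ is an instance of some $\alpha_i$ or some $\alpha_i^{-1}$ with source expression $E_{t-1}$ and target expression $E_t$; the empty composition ($s=0$) is the identity. Uniqueness means that any two such paths from $E$ to $F$ compose to the same natural isomorphism. *)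

(* Defs.v *)
From Stdlib Require Import FunctionalExtensionality.
From mathcomp Require Import all_boot.

(* Categories are set up here, with
   equality of morphisms being Leibniz equality (functional extensionality is
   used for the laws of the power categories). *)

Set Implicit Arguments.
Unset Strict Implicit.
Unset Printing Implicit Defensive.

Record category := Category {
  ob :> Type;
  hom : ob -> ob -> Type;
  idm : forall x, hom x x;
  cmp : forall x y z, hom y z -> hom x y -> hom x z;
  cmp1m : forall x y (f : hom x y), cmp (idm y) f = f;
  cmpm1 : forall x y (f : hom x y), cmp f (idm x) = f;
  cmpA : forall x y z t (h : hom z t) (g : hom y z) (f : hom x y),
    cmp h (cmp g f) = cmp (cmp h g) f }.

Arguments hom {c} x y.
Arguments idm {c} x.
Arguments cmp {c x y z} g f.

#[local] Obligation Tactic := idtac.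

Declare Scope cat_scope.
Delimit Scope cat_scope with cat.
Local Open Scope cat_scope.
Notation "g ∘ f" := (cmp g f) (at level 40, left associativity) : cat_scope.

Record functor (C D : category) := Functor {
  fob :> C -> D;
  fmap : forall x y, hom x y -> hom (fob x) (fob y);
  fmap1 : forall x, fmap (idm x) = idm (fob x);
  fmapM : forall x y z (g : hom y z) (f : hom x y),
    fmap (g ∘ f) = fmap g ∘ fmap f }.

Arguments fmap {C D} _ {x y} _.

Record natiso (C D : category) (S T : functor C D) := NatIso {
  ni :> forall x, hom (S x) (T x);
  ni_inv : forall x, hom (T x) (S x);
  ni_nat : forall x y (f : hom x y), fmap T f ∘ ni x = ni y ∘ fmap S f;
  niK : forall x, ni_inv x ∘ ni x = idm (S x);
  niVK : forall x, ni x ∘ ni_inv x = idm (T x) }.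

Program Definition prod_cat (C D : category) : category :=
  @Category (C * D)%type
    (fun x y => (hom x.1 y.1 * hom x.2 y.2)%type)
    (fun x => (idm x.1, idm x.2))
    (fun x y z g f => (g.1 ∘ f.1, g.2 ∘ f.2)) _ _ _.
Next Obligation. by move=> C D x y [f g] /=; rewrite !cmp1m. Qed.
Next Obligation. by move=> C D x y [f g] /=; rewrite !cmpm1. Qed.
Next Obligation. by move=> C D x y z t h g f /=; rewrite !cmpA. Qed.

Program Definition pow_cat (C : category) (I : Type) : category :=
  @Category (I -> C)
    (fun A B => forall i, hom (A i) (B i))
    (fun A i => idm (A i))
    (fun A B D g f i => g i ∘ f i) _ _ _.
Next Obligation.
by move=> C I A B f; apply: functional_extensionality_dep => i; apply: cmp1m.
Qed.
Next Obligation.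
by move=> C I A B f; apply: functional_extensionality_dep => i; apply: cmpm1.
Qed.
Next Obligation.
move=> C I A B D E h g f.
by apply: functional_extensionality_dep => i; apply: cmpA.
Qed.

Program Definition functor_comp (B C D : category)
    (T : functor C D) (G : functor B C) : functor B D :=
  @Functor B D (fun x => T (G x)) (fun x y f => fmap T (fmap G f)) _ _.
Next Obligation. by move=> B C D T G x /=; rewrite !fmap1. Qed.
Next Obligation. by move=> B C D T G x y z g f /=; rewrite !fmapM. Qed.

Program Definition proj_functor (C : category) (I : Type) (i : I) :
    functor (pow_cat C I) C :=
  @Functor (pow_cat C I) C (fun A => A i) (fun A B f => f i) _ _.
Next Obligation. by []. Qed.
Next Obligation. by []. Qed.

Program Definition tuple_functor (B C : category) (I : Type)
    (T : I -> functor B C) : functor B (pow_cat C I) :=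
  @Functor B (pow_cat C I) (fun x i => T i x) (fun x y f i => fmap (T i) f) _ _.
Next Obligation.
by move=> B C I T x; apply: functional_extensionality_dep => i; apply: fmap1.
Qed.
Next Obligation.
move=> B C I T x y z g f.
by apply: functional_extensionality_dep => i; apply: fmapM.
Qed.

Program Definition natiso_id (C D : category) (T : functor C D) : natiso T T :=
  @NatIso C D T T (fun x => idm (T x)) (fun x => idm (T x)) _ _ _.
Next Obligation. by move=> C D T x y f /=; rewrite cmp1m cmpm1. Qed.
Next Obligation. by move=> C D T x /=; rewrite cmp1m. Qed.
Next Obligation. by move=> C D T x /=; rewrite cmp1m. Qed.

Program Definition natiso_inv (C D : category) (S T : functor C D)
    (b : natiso S T) : natiso T S :=
  @NatIso C D T S (ni_inv b) (ni b) _ (niVK b) (niK b).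
Next Obligation.
move=> C D S T b x y f /=.
rewrite -[LHS]cmp1m -(niK b) -cmpA; congr cmp.
by rewrite cmpA -ni_nat -cmpA niVK cmpm1.
Qed.

Program Definition natiso_comp (C D : category) (S T U : functor C D)
    (c : natiso T U) (b : natiso S T) : natiso S U :=
  @NatIso C D S U (fun x => c x ∘ b x) (fun x => ni_inv b x ∘ ni_inv c x) _ _ _.
Next Obligation. by move=> C D S T U c b x y f /=; rewrite cmpA ni_nat -!cmpA ni_nat. Qed.
Next Obligation.
by move=> C D S T U c b x /=; rewrite cmpA -(cmpA _ _ (c x)) niK cmpm1 niK.
Qed.
Next Obligation.
by move=> C D S T U c b x /=; rewrite cmpA -(cmpA _ _ (ni_inv b x)) niVK cmpm1 niVK.
Qed.

Program Definition natiso_pre (B C D : category) (S T : functor C D)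
    (b : natiso S T) (G : functor B C) :
    natiso (functor_comp S G) (functor_comp T G) :=
  @NatIso B D (functor_comp S G) (functor_comp T G)
    (fun x => b (G x)) (fun x => ni_inv b (G x)) _ _ _.
Next Obligation. by move=> B C D S T b G x y f; apply: (ni_nat b (fmap G f)). Qed.
Next Obligation. by move=> B C D S T b G x; apply: (niK b). Qed.
Next Obligation. by move=> B C D S T b G x; apply: (niVK b). Qed.

Program Definition mul_functor (B C : category) (mul : functor (prod_cat C C) C)
    (S T : functor B C) : functor B C :=
  @Functor B C (fun x => mul (S x, T x))
    (fun x y f =>
       @fmap _ _ mul (S x, T x) (S y, T y) (fmap S f, fmap T f)) _ _.
Next Obligation. by move=> B C mul S T x /=; rewrite (fmap1 S) (fmap1 T); apply: (fmap1 mul (S x, T x)). Qed.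
Next Obligation. by move=> B C mul S T x y z g f /=; rewrite (fmapM S) (fmapM T);
  apply: (fmapM mul (x := (S x, T x)) (y := (S y, T y)) (z := (S z, T z)) (fmap S g, fmap T g) (fmap S f, fmap T f)). Qed.

Program Definition mul_natiso (B C : category) (mul : functor (prod_cat C C) C)
    (S S' T T' : functor B C) (b : natiso S S') (c : natiso T T') :
    natiso (mul_functor mul S T) (mul_functor mul S' T') :=
  @NatIso B C (mul_functor mul S T) (mul_functor mul S' T')
    (fun x => @fmap _ _ mul (S x, T x) (S' x, T' x) (b x, c x))
    (fun x => @fmap _ _ mul (S' x, T' x) (S x, T x) (ni_inv b x, ni_inv c x))
    _ _ _.
Next Obligation. move=> B C mul S S' T T' b c x y f /=.
rewrite -(fmapM mul (x := (S x, T x)) (y := (S' x, T' x)) (z := (S' y, T' y))).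
rewrite -(fmapM mul (x := (S x, T x)) (y := (S y, T y)) (z := (S' y, T' y))).
by rewrite /= !ni_nat. Qed.
Next Obligation. move=> B C mul S S' T T' b c x /=.
rewrite -(fmapM mul (x := (S x, T x)) (y := (S' x, T' x)) (z := (S x, T x))).
by rewrite /= !niK; apply: (fmap1 mul (S x, T x)). Qed.
Next Obligation. move=> B C mul S S' T T' b c x /=.
rewrite -(fmapM mul (x := (S' x, T' x)) (y := (S x, T x)) (z := (S' x, T' x))).
by rewrite /= !niVK; apply: (fmap1 mul (S' x, T' x)). Qed.

Inductive word (I : Type) : Type :=
| Var of I
| Mul of word I & word I.

Fixpoint vars (I : Type) (E : word I) : seq I :=
  match E with Var i => [:: i] | Mul P Q => vars P ++ vars Q end.

(* A word may repeat, omit or permute its variables; an expression in n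
   variables has each of X_1, ..., X_n once, in this order.  The variables
   X_1, ..., X_n are indexed by 0, ..., n-1.  A word has at least one variable,
   so n >= 1 whenever there is an expression in n variables. *)
Definition is_expression (n : nat) (E : word 'I_n) : Prop :=
  vars E = enum 'I_n.

Fixpoint word_functor (C : category) (mul : functor (prod_cat C C) C)
    (I : Type) (E : word I) : functor (pow_cat C I) C :=
  match E with
  | Var i => proj_functor C i
  | Mul P Q => mul_functor mul (word_functor mul P) (word_functor mul Q)
  end.

Definition X3 (k : nat) (hk : k < 3) : word 'I_3 := Var (Ordinal hk).

Definition assoc_src : word 'I_3 :=
  Mul (X3 (k := 0) isT) (Mul (X3 (k := 1) isT) (X3 (k := 2) isT)).
Definition assoc_tgt : word 'I_3 :=
  Mul (Mul (X3 (k := 0) isT) (X3 (k := 1) isT)) (X3 (k := 2) isT).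

Definition init_ord (m : nat) (k : 'I_m) : 'I_m.+1 := widen_ord (leqnSn m) k.

(* (A_1, ..., A_m, D) |-> T (A_1, ..., A_m) (x) D. *)
Definition rstab (C : category) (mul : functor (prod_cat C C) C) (m : nat)
    (T : functor (pow_cat C 'I_m) C) : functor (pow_cat C 'I_m.+1) C :=
  mul_functor mul
    (functor_comp T (tuple_functor (fun k => proj_functor C (init_ord k))))
    (proj_functor C ord_max).

Definition rstab_natiso (C : category) (mul : functor (prod_cat C C) C)
    (m : nat) (S T : functor (pow_cat C 'I_m) C) (b : natiso S T) :
    natiso (rstab mul S) (rstab mul T) :=
  mul_natiso mul
    (natiso_pre b (tuple_functor (fun k => proj_functor C (init_ord k))))
    (natiso_id (proj_functor C ord_max)).

Fixpoint rstab_iter (C : category) (mul : functor (prod_cat C C) C)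
    (T : functor (pow_cat C 'I_3) C) (i : nat) :
    functor (pow_cat C 'I_(i + 3)) C :=
  match i with
  | 0 => T
  | j.+1 => rstab mul (rstab_iter mul T j)
  end.

Fixpoint rstab_iter_natiso (C : category) (mul : functor (prod_cat C C) C)
    (S T : functor (pow_cat C 'I_3) C) (b : natiso S T) (i : nat) :
    natiso (rstab_iter mul S i) (rstab_iter mul T i) :=
  match i with
  | 0 => b
  | j.+1 => rstab_natiso mul (rstab_iter_natiso mul b j)
  end.

Fixpoint subst (I J : Type) (s : I -> word J) (e : word I) : word J :=
  match e with
  | Var i => s i
  | Mul P Q => Mul (subst s P) (subst s Q)
  end.

(* The result of substituting s for the variables of
   (...((e (x) X_4) (x) X_5) ...) (x) X_{i+3}. *)
Fixpoint rstab_subst (J : Type) (e : word 'I_3) (i : nat) :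
    ('I_(i + 3) -> word J) -> word J :=
  match i with
  | 0 => fun s => subst s e
  | j.+1 => fun s : 'I_(j + 3).+1 -> word J =>
      Mul (rstab_subst e (fun k => s (init_ord k))) (s ord_max)
  end.

Definition words_functor (C : category) (mul : functor (prod_cat C C) C)
    (I J : Type) (s : I -> word J) : functor (pow_cat C J) (pow_cat C I) :=
  tuple_functor (fun i => word_functor mul (s i)).

(* The functor represented by a substituted word is the original functor
   precomposed with the substituted words.  The two functors have the same
   values, but for a variable word the equality is only propositional; the
   isomorphisms below are the resulting identifications, with all components
   identities (see [rstab_subst_natisoE]). *)
Definition subst_natiso (C : category) (mul : functor (prod_cat C C) C)
    (I J : Type) (s : I -> word J) :=
  fix loop (e : word I) : natiso (word_functor mul (subst s e))
      (functor_comp (word_functor mul e) (words_functor mul s)) :=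
  match e with
  | Var i =>
      let b := natiso_id (word_functor mul (s i)) in
      @NatIso _ _ (word_functor mul (s i))
        (functor_comp (proj_functor C i) (words_functor mul s))
        (ni b) (ni_inv b) (@ni_nat _ _ _ _ b) (niK b) (niVK b)
  | Mul P Q =>
      let b := mul_natiso mul (loop P) (loop Q) in
      @NatIso _ _
        (mul_functor mul (word_functor mul (subst s P))
           (word_functor mul (subst s Q)))
        (functor_comp (mul_functor mul (word_functor mul P) (word_functor mul Q))
           (words_functor mul s))
        (ni b) (ni_inv b) (@ni_nat _ _ _ _ b) (niK b) (niVK b)
  end.

Fixpoint rstab_subst_natiso (C : category) (mul : functor (prod_cat C C) C)
    (J : Type) (e : word 'I_3) (i : nat) :
    forall s : 'I_(i + 3) -> word J,
      natiso (word_functor mul (rstab_subst e s))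
        (functor_comp (rstab_iter mul (word_functor mul e) i)
           (words_functor mul s)) :=
  match i with
  | 0 => fun s => subst_natiso mul s e
  | j.+1 => fun s : 'I_(j + 3).+1 -> word J =>
      let b := mul_natiso mul
        (rstab_subst_natiso mul e (fun k => s (init_ord k)))
        (natiso_id (word_functor mul (s ord_max))) in
      @NatIso _ _
        (mul_functor mul
           (word_functor mul (rstab_subst e (fun k => s (init_ord k))))
           (word_functor mul (s ord_max)))
        (functor_comp (rstab mul (rstab_iter mul (word_functor mul e) j))
           (words_functor mul s))
        (ni b) (ni_inv b) (@ni_nat _ _ _ _ b) (niK b) (niVK b)
  end.

Definition eq_hom (C : category) (x y : C) (h : x = y) : hom x y :=
  eq_rect x (hom x) (idm x) y h.

Lemma fmap_eq_hom (C : category) (mul : functor (prod_cat C C) C)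
    (x x' y y' : C) (h : x = x') (k : y = y') :
  exists l : mul (x, y) = mul (x', y'),
    @fmap _ _ mul (x, y) (x', y') (eq_hom h, eq_hom k) = eq_hom l.
Proof. by case: x' / h; case: y' / k; exists erefl; rewrite /= -fmap1. Qed.

Lemma subst_natisoE (C : category) (mul : functor (prod_cat C C) C)
    (I J : Type) (s : I -> word J) (e : word I) (A : J -> C) :
  exists h, subst_natiso mul s e A = eq_hom h.
Proof.
elim: e => [i|P [hP eP] Q [hQ eQ]] /=; first by exists erefl.
by rewrite eP eQ; apply: fmap_eq_hom.
Qed.

Lemma rstab_subst_natisoE (C : category) (mul : functor (prod_cat C C) C)
    (J : Type) (e : word 'I_3) (i : nat) (s : 'I_(i + 3) -> word J)
    (A : J -> C) :
  exists h, rstab_subst_natiso mul e s A = eq_hom h.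
Proof.
elim: i s => [|i IHi] s /=; first exact: subst_natisoE.
have [h ->] := IHi (fun k => s (init_ord k)).
exact: (fmap_eq_hom mul h erefl).
Qed.

(* The i-th right stabilization of b, precomposed with the functor given by s,
   as an isomorphism between the functors represented by its source and target
   words. *)
Definition instance (C : category) (mul : functor (prod_cat C C) C)
    (J : Type) (e f : word 'I_3)
    (b : natiso (word_functor mul e) (word_functor mul f))
    (i : nat) (s : 'I_(i + 3) -> word J) :
    natiso (word_functor mul (rstab_subst e s))
      (word_functor mul (rstab_subst f s)) :=
  natiso_comp (natiso_inv (rstab_subst_natiso mul f s))
    (natiso_comp
       (natiso_pre (rstab_iter_natiso mul b i) (words_functor mul s))
       (rstab_subst_natiso mul e s)).

(* Words s_1, ..., s_k with X_1, ..., X_n in total, in this order: the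
   renumbering of the variables of k expressions. *)
Definition in_order (k n : nat) (s : 'I_k -> word 'I_n) : Prop :=
  flatten [seq vars (s j) | j <- enum 'I_k] = enum 'I_n.

(* The substituted words are in order, so that both ends of a step are
   expressions in n variables (see [step_expression]). *)
Inductive step (n : nat) : word 'I_n -> word 'I_n -> Type :=
| Step (i : nat) (s : 'I_(i + 3) -> word 'I_n) :
    in_order s -> step (rstab_subst assoc_src s) (rstab_subst assoc_tgt s)
| StepV (i : nat) (s : 'I_(i + 3) -> word 'I_n) :
    in_order s -> step (rstab_subst assoc_tgt s) (rstab_subst assoc_src s).

Lemma vars_rstab_subst (J : Type) (e : word 'I_3) (i : nat)
    (s : 'I_(i + 3) -> word J) :
  is_expression e ->
  vars (rstab_subst e s) = flatten [seq vars (s j) | j <- enum 'I_(i + 3)].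
Proof.
move=> he; elim: i s => [|i IHi] s.
  rewrite -[enum _]he /=; elim: (e) => [j|P IHP Q IHQ] /=; first by rewrite cats0.
  by rewrite IHP IHQ map_cat flatten_cat.
have -> : enum 'I_(i.+1 + 3) =
    rcons [seq init_ord k | k <- enum 'I_(i + 3)] ord_max.
  exact: enum_ordSr.
rewrite map_rcons -cats1 flatten_cat -map_comp [flatten [:: _]]/= cats0.
by rewrite -(IHi (fun k => s (init_ord k))).
Qed.

Lemma step_expression (n : nat) (E F : word 'I_n) :
  step E F -> is_expression E /\ is_expression F.
Proof.
have hs : is_expression assoc_src.
  by rewrite /is_expression; apply: (inj_map val_inj); rewrite val_enum_ord.
have ht : is_expression assoc_tgt.
  by rewrite /is_expression; apply: (inj_map val_inj); rewrite val_enum_ord.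
by case=> i s hi; split; rewrite /is_expression vars_rstab_subst.
Qed.

Inductive steps (n : nat) : word 'I_n -> word 'I_n -> Type :=
| Nil E : steps E E
| Cons E F G : step E F -> steps F G -> steps E G.

Definition step_natiso (C : category) (mul : functor (prod_cat C C) C)
    (alpha : natiso (word_functor mul assoc_src) (word_functor mul assoc_tgt))
    (n : nat) (E F : word 'I_n) (p : step E F) :
    natiso (word_functor mul E) (word_functor mul F) :=
  match p with
  | Step _ s _ => instance alpha s
  | StepV _ s _ => instance (natiso_inv alpha) s
  end.

Fixpoint composite (C : category) (mul : functor (prod_cat C C) C)
    (alpha : natiso (word_functor mul assoc_src) (word_functor mul assoc_tgt))
    (n : nat) (E F : word 'I_n) (p : steps E F) :
    natiso (word_functor mul E) (word_functor mul F) :=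
  match p with
  | Nil E => natiso_id (word_functor mul E)
  | Cons _ _ _ q r => natiso_comp (composite alpha r) (step_natiso alpha q)
  end.

(* Main.v *)
Require Import Defs.
From Stdlib Require Import FunctionalExtensionality ProofIrrelevance Eqdep_dec.
From mathcomp Require Import all_boot.

(** Read a word along its left spine, as (...((X ⊗ T_1) ⊗ T_2) ...) ⊗ T_k with X
    a variable.  An instance of α_i replaces one factor T_j = B ⊗ C by the two
    factors B, C, and nothing happens inside a factor before it is split.  So
    two distinct instances with the same source split different factors, and
    they commute by naturality of α.  The critical pair that would
    call for the pentagon needs α inside a right-hand factor, which right
    stabilization does not provide.

    Splitting until all factors are variables leads from a word E to the word
    [normal E], which depends only on the variables of E ([normal_vars]), and
    splitting in one fixed order gives a morphism [normalize E] from E to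
    [normal E].  By naturality of α, an instance f : E -> F satisfies
    normal E = normal F and normalize E = normalize F ∘ f
    ([normal_cone_instance]).  The equation passes to inverses and composites,
    so it holds for every composition of instances from E to F; as
    [normalize F] has a left inverse, such a composition is determined by its
    ends ([composite_unique]).

    A composition exists because both expressions can be split down to their
    common normal form, and the path from F can be reversed ([steps_exist]). *)

Set Implicit Arguments.
Unset Strict Implicit.
Unset Printing Implicit Defensive.

Local Open Scope cat_scope.

(** * Words bracketed from the left *)

(** Splits the last factor Q of P ⊗ Q, and then its parts, down to variables. *)
Fixpoint append (I : Type) (P Q : word I) : word I :=
  match Q with
  | Var i => Mul P (Var i)
  | Mul B C => append (append P B) C
  end.

Fixpoint normal (I : Type) (E : word I) : word I :=
  match E with
  | Var i => Var i
  | Mul P Q => append (normal P) Q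
  end.

Lemma appendE (I : Type) (P Q : word I) :
  append P Q = foldl (fun N i => Mul N (Var i)) P (vars Q).
Proof.
elim: Q P => [i|B IHB C IHC] P //=.
by rewrite IHC IHB foldl_cat.
Qed.

Lemma vars_append (I : Type) (P Q : word I) :
  vars (append P Q) = vars P ++ vars Q.
Proof.
by elim: Q P => [i|B IHB D IHD] P //=; rewrite IHD IHB catA.
Qed.

Lemma vars_normal (I : Type) (E : word I) : vars (normal E) = vars E.
Proof. by elim: E => [i|P IHP Q _] //=; rewrite vars_append IHP. Qed.

Lemma normalE (I : Type) (E : word I) : exists i s,
  vars E = i :: s /\ normal E = foldl (fun N j => Mul N (Var j)) (Var i) s.
Proof.
elim: E => [i|P [i [s [eP nP]]] Q _] /=; first by exists i, [::].
by exists i, (s ++ vars Q); rewrite eP nP appendE foldl_cat.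
Qed.

Lemma normal_vars (I : Type) (E F : word I) :
  vars E = vars F -> normal E = normal F.
Proof.
have [i [s [eE ->]]] := normalE E; have [j [t [eF ->]]] := normalE F.
by rewrite eE eF => -[-> ->].
Qed.

(** Morphisms into [normal E] and [normal F] will be compared as dependent pairs;
    a decidable equality of words makes the second component of such a pair
    well defined. *)
Lemma word_eq_dec (I : eqType) (E F : word I) : {E = F} + {E <> F}.
Proof. by decide equality; apply: eq_comparable. Qed.

(** * Multiplication of morphisms and alpha on three objects *)

Section Coherence.

Context (C : category) (mul : functor (prod_cat C C) C).

Definition tensor (x y x' y' : C) (f : hom x x') (g : hom y y') :
    hom (mul (x, y)) (mul (x', y')) :=
  @fmap _ _ mul (x, y) (x', y') (f, g).

Lemma tensor_cmp (x y z x' y' z' : C) (g : hom y z) (f : hom x y)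
    (g' : hom y' z') (f' : hom x' y') :
  tensor (g ∘ f) (g' ∘ f') = tensor g g' ∘ tensor f f'.
Proof.
exact: (fmapM mul (x := (x, x')) (y := (y, y')) (z := (z, z')) (g, g') (f, f')).
Qed.

Lemma tensor1 (x y : C) : tensor (idm x) (idm y) = idm (mul (x, y)).
Proof. exact: (fmap1 mul (x, y)). Qed.

Definition split_mono (x y : C) (f : hom x y) : Prop :=
  exists g, g ∘ f = idm x.

Lemma split_mono_cmp (x y z : C) (g : hom y z) (f : hom x y) :
  split_mono g -> split_mono f -> split_mono (g ∘ f).
Proof.
move=> [g' eg] [f' ef]; exists (f' ∘ g').
by rewrite -cmpA (cmpA g') eg cmp1m.
Qed.

Lemma split_mono_tensor (x y z : C) (f : hom x y) :
  split_mono f -> split_mono (tensor f (idm z)).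
Proof.
by move=> [g eg]; exists (tensor g (idm z)); rewrite -tensor_cmp eg cmp1m tensor1.
Qed.

(** Defined through the value of the index, so that [triple] and [triple_hom]
    compute at an ordinal with any proof of its bound, in particular at the
    opaque proofs that occur in [assoc_src] and [assoc_tgt]. *)
Definition triple (x y z : C) : 'I_3 -> C :=
  fun k => match nat_of_ord k with 0 => x | 1 => y | _ => z end.

Definition triple_hom (x y z x' y' z' : C) (f : hom x x') (g : hom y y')
    (h : hom z z') (k : 'I_3) : hom (triple x y z k) (triple x' y' z' k) :=
  match nat_of_ord k as m return
    hom (match m with 0 => x | 1 => y | _ => z end)
        (match m with 0 => x' | 1 => y' | _ => z' end)
  with 0 => f | 1 => g | _ => h end.

Lemma ord3P (T : 'I_3 -> Prop) :
  T (Ordinal (isT : 0 < 3)) -> T (Ordinal (isT : 1 < 3)) ->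
  T (Ordinal (isT : 2 < 3)) -> forall k, T k.
Proof.
by move=> T0 T1 T2 [[|[|[|]]] h] //; rewrite (bool_irrelevance h isT).
Qed.

Lemma triple_eta (B : 'I_3 -> C) (k : 'I_3) :
  B k = triple (B (Ordinal (isT : 0 < 3))) (B (Ordinal (isT : 1 < 3)))
          (B (Ordinal (isT : 2 < 3))) k.
Proof. by elim/ord3P: k. Qed.

Context (alpha : natiso (word_functor mul assoc_src) (word_functor mul assoc_tgt)).

Definition assoc (x y z : C) :
    hom (mul (x, mul (y, z))) (mul (mul (x, y), z)) :=
  alpha (triple x y z).

Lemma assoc_natural (x y z x' y' z' : C) (f : hom x x') (g : hom y y')
    (h : hom z z') :
  tensor (tensor f g) h ∘ assoc x y z = assoc x' y' z' ∘ tensor f (tensor g h).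
Proof. exact: (ni_nat alpha (triple_hom f g h)). Qed.

Lemma assoc_split_mono (x y z : C) : split_mono (assoc x y z).
Proof.
by exists (ni_inv alpha (triple x y z)); exact: (niK alpha (triple x y z)).
Qed.

(** An arbitrary family B and the [triple] of its values are equal only
    propositionally; naturality of alpha along the identities eq_hom between
    them transports one component of alpha to the other. *)
Lemma alphaE (B : 'I_3 -> C) :
  alpha B = assoc (B (Ordinal (isT : 0 < 3))) (B (Ordinal (isT : 1 < 3)))
              (B (Ordinal (isT : 2 < 3))).
Proof.
have eq_hom1 (x : C) (h : x = x) : eq_hom h = idm x.
  by rewrite (proof_irrelevance _ h erefl).
have := ni_nat alpha (y := triple _ _ _) (fun k => eq_hom (triple_eta B k)).
rewrite /= !eq_hom1 -!/(tensor _ _) !tensor1 => e.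
by rewrite -[LHS]cmp1m e cmpm1.
Qed.

(** * Instances of alpha *)

Section Components.

Context (J : Type) (A : J -> C).

Local Notation ob P := (word_functor mul P A).

(** The comparison isomorphisms in the definition of [instance] are products of
    identities, so that only the component of alpha remains. *)
Lemma instance0 (s : 'I_3 -> word J) :
  instance alpha (i := 0) s A =
  assoc (ob (s (Ordinal (isT : 0 < 3)))) (ob (s (Ordinal (isT : 1 < 3))))
        (ob (s (Ordinal (isT : 2 < 3)))).
Proof.
rewrite /= -!/(tensor _ _) !tensor1 cmp1m cmpm1.
exact: alphaE.
Qed.

(** With [instance0], this gives an induction on the number of stabilizations
    in which the comparison isomorphisms no longer appear. *)
Lemma instanceS (i : nat) (s : 'I_(i + 3).+1 -> word J) :
  instance alpha (i := i.+1) s A =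
  tensor (instance alpha (fun k => s (init_ord k)) A) (idm (ob (s ord_max))).
Proof. by rewrite /= -!/(tensor _ _) -!tensor_cmp !cmp1m. Qed.

Lemma instanceV (i : nat) (s : 'I_(i + 3) -> word J) :
  instance (natiso_inv alpha) s A = ni_inv (instance alpha s) A.
Proof.
have e (B : 'I_(i + 3) -> C) :
    rstab_iter_natiso mul (natiso_inv alpha) i B =
    ni_inv (rstab_iter_natiso mul alpha i) B.
  by elim: i {s} B => [|i IHi] B //=; rewrite IHi.
by rewrite /= e cmpA.
Qed.

(** * Normalization of words *)

(** The composite of the splittings that lead from P ⊗ Q to [append P Q]. *)
Fixpoint reassoc (Q P : word J) : hom (mul (ob P, ob Q)) (ob (append P Q)) :=
  match Q with
  | Var i => idm (mul (ob P, A i))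
  | Mul B D =>
      reassoc D (append P B) ∘ tensor (reassoc B P) (idm (ob D))
        ∘ assoc (ob P) (ob B) (ob D)
  end.

Fixpoint normalize (E : word J) : hom (ob E) (ob (normal E)) :=
  match E with
  | Var i => idm (A i)
  | Mul P Q => reassoc Q (normal P) ∘ tensor (normalize P) (idm (ob Q))
  end.

Lemma reassoc_split_mono (Q P : word J) : split_mono (reassoc Q P).
Proof.
elim: Q P => [i|B IHB D IHD] P /=; first by exists (idm _); rewrite cmp1m.
do 2?apply: split_mono_cmp => //; first exact: split_mono_tensor.
exact: assoc_split_mono.
Qed.

Lemma normalize_split_mono (E : word J) : split_mono (normalize E).
Proof.
elim: E => [i|P IHP Q _] /=; first by exists (idm _); rewrite cmp1m.
by apply: split_mono_cmp; [apply: reassoc_split_mono|apply: split_mono_tensor].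
Qed.

(** The target is packed with the morphism because [normal E] and [normal F] are
    equal, but not convertible, for the two ends E, F of an instance.  So
    [normalize E] and [normalize F] can be compared without transports. *)
Definition cone (x : C) : Type := {N : word J & hom x (ob N)}.

Definition precomp (x y : C) (m : cone y) (f : hom x y) : cone x :=
  existT _ (projT1 m) (projT2 m ∘ f).

Definition normal_cone (E : word J) : cone (ob E) :=
  existT _ (normal E) (normalize E).

(** Right stabilization: the normalization of P ⊗ Q normalizes P first, so it sees
    P only through its normalization. *)
Lemma normal_cone_mul (P P' Q : word J) (f : hom (ob P) (ob P')) :
  normal_cone P = precomp (normal_cone P') f ->
  normal_cone (Mul P Q) =
  precomp (normal_cone (Mul P' Q)) (tensor f (idm (ob Q))).
Proof.
pose mulQ (x : C) (m : cone x) : cone (mul (x, ob Q)) :=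
  existT _ (append (projT1 m) Q)
    (reassoc Q (projT1 m) ∘ tensor (projT2 m) (idm (ob Q))).
move=> e; rewrite -[LHS]/(mulQ _ (normal_cone P)) e /mulQ /precomp /=.
by rewrite -cmpA -tensor_cmp cmp1m.
Qed.

(** The normalization of P ⊗ (B ⊗ D) applies alpha after having normalized P,
    whereas the instance of alpha comes before any normalization; naturality
    in the first argument exchanges the two. *)
Lemma normal_cone_assoc (P B D : word J) :
  normal_cone (Mul P (Mul B D)) =
  precomp (normal_cone (Mul (Mul P B) D)) (assoc (ob P) (ob B) (ob D)).
Proof.
congr existT => /=.
rewrite -!cmpA -[idm (mul _)]tensor1 -assoc_natural !cmpA; congr (_ ∘ _).
by rewrite -!cmpA -!tensor_cmp !cmp1m.
Qed.

Lemma normal_cone_instance (i : nat) (s : 'I_(i + 3) -> word J) :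
  normal_cone (rstab_subst assoc_src s) =
  precomp (normal_cone (rstab_subst assoc_tgt s)) (instance alpha s A).
Proof.
elim: i s => [|i IHi] s; first by rewrite instance0; apply: normal_cone_assoc.
by rewrite instanceS; apply: normal_cone_mul.
Qed.

Lemma precomp_cmp (x y z : C) (m : cone z) (g : hom y z) (f : hom x y) :
  precomp (precomp m g) f = precomp m (g ∘ f).
Proof. by rewrite /precomp /= cmpA. Qed.

Lemma precomp1 (x : C) (m : cone x) : precomp m (idm x) = m.
Proof. by case: m => N f; rewrite /precomp /= cmpm1. Qed.

End Components.

(** * Uniqueness *)

Lemma normal_cone_step (n : nat) (A : 'I_n -> C) (E F : word 'I_n)
    (p : step E F) :
  normal_cone A E = precomp (normal_cone A F) (step_natiso alpha p A).
Proof.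
case: p => i s hs; first exact: normal_cone_instance.
rewrite [step_natiso _ _ _]instanceV normal_cone_instance precomp_cmp.
by rewrite (niVK (instance alpha s) A) precomp1.
Qed.

Lemma normal_cone_composite (n : nat) (A : 'I_n -> C) (E F : word 'I_n)
    (p : steps E F) :
  normal_cone A E = precomp (normal_cone A F) (composite alpha p A).
Proof.
elim: p => [G|G H K q r IHr]; first by rewrite precomp1.
by rewrite (normal_cone_step A q) IHr precomp_cmp.
Qed.

(** The inverse components are determined by the components. *)
Lemma natiso_eq (D D' : category) (S T : functor D D') (b c : natiso S T) :
  (forall x, b x = c x) -> b = c.
Proof.
case: b c => [b b' nb bK bVK] [c c' nc cK cVK] /= e.
have eb : b = c by apply: functional_extensionality_dep.
case: c / eb nc cK cVK {e} => nc cK cVK.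
have eb' : b' = c'.
  apply: functional_extensionality_dep => x.
  by rewrite -[LHS]cmpm1 -(cVK x) cmpA bK cmp1m.
case: c' / eb' cK cVK => cK cVK.
by f_equal; apply: proof_irrelevance.
Qed.

Lemma composite_unique (n : nat) (E F : word 'I_n) (p q : steps E F) :
  composite alpha p = composite alpha q.
Proof.
apply: natiso_eq => A.
have e : normalize A F ∘ composite alpha p A =
    normalize A F ∘ composite alpha q A.
  apply: (inj_pair2_eq_dec _ (@word_eq_dec _)
    (fun N => hom (word_functor mul E A) (word_functor mul N A))).
  exact: etrans (esym (normal_cone_composite A p)) (normal_cone_composite A q).
have [g gK] := normalize_split_mono A F.
by rewrite -[LHS]cmp1m -gK -cmpA e cmpA gK cmp1m.
Qed.

End Coherence.

(** * Existence *)

Section Paths.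

Context (n : nat).

Implicit Types (E F P Q : word 'I_n) (l : seq (word 'I_n)).

Fixpoint steps_cat E F G (p : steps E F) : steps F G -> steps E G :=
  match p with
  | Defs.Nil _ => fun q => q
  | Defs.Cons _ _ _ r p' => fun q => Defs.Cons r (steps_cat p' q)
  end.

Definition step_rev E F (p : step E F) : step F E :=
  match p with
  | Step _ s hs => StepV hs
  | StepV _ s hs => Step hs
  end.

Fixpoint steps_rev E F (p : steps E F) : steps F E :=
  match p with
  | Defs.Nil E => Defs.Nil E
  | Defs.Cons _ _ _ r p' =>
      steps_cat (steps_rev p') (Defs.Cons (step_rev r) (Defs.Nil _))
  end.

(** Steps happen on the left spine, under further factors.  Carrying these factors
    as a list replaces an argument that multiplies paths on the right: a step is
    between expressions in all n variables, so that no path starts at the part P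
    of an expression P ⊗ Q. *)
Definition stack P l : word 'I_n := foldl (@Mul _) P l.

Lemma vars_stack P l : vars (stack P l) = vars P ++ flatten (map (@vars _) l).
Proof.
by elim: l P => [|Q l IHl] P; rewrite /= ?cats0 // IHl catA.
Qed.

Definition triple_word P Q G (k : 'I_3) : word 'I_n :=
  match nat_of_ord k with 0 => P | 1 => Q | _ => G end.

Definition family_rcons (i : nat) (s : 'I_(i + 3) -> word 'I_n) Q
    (k : 'I_(i + 3).+1) : word 'I_n :=
  oapp s Q (unlift ord_max k).

(** The number i of stabilizations is the size of l.  The same family s serves
    the source and the target of alpha. *)
Lemma stack_rstab_subst P Q G l : exists i (s : 'I_(i + 3) -> word 'I_n),
  forall e, rstab_subst e s = stack (subst (triple_word P Q G) e) l.
Proof.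
elim/last_ind: l => [|l K [i [s es]]]; first by exists 0, (triple_word P Q G).
exists i.+1, (family_rcons s K) => e.
rewrite /stack foldl_rcons -/(stack _ _) -es /= /family_rcons unlift_none.
congr (Mul (rstab_subst e _) _); apply: functional_extensionality => k.
suff -> : init_ord k = lift ord_max k by rewrite liftK.
by apply: val_inj; rewrite /= /bump leqNgt ltn_ord.
Qed.

Lemma stack_step P Q G l : is_expression (stack (Mul P (Mul Q G)) l) ->
  inhabited (step (stack (Mul P (Mul Q G)) l) (stack (Mul (Mul P Q) G) l)).
Proof.
have [i [s es]] := stack_rstab_subst P Q G l.
rewrite -[stack (Mul P _) l](es assoc_src) -[stack (Mul _ G) l](es assoc_tgt).
move=> h; constructor; constructor; rewrite /in_order -h vars_rstab_subst //.
by apply: (inj_map val_inj); rewrite val_enum_ord.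
Qed.

(** After the factor B ⊗ D is split, its parts are treated in the order of
    [append]: B with D as one more factor above it, then D. *)
Lemma stack_append P Q l : is_expression (stack (Mul P Q) l) ->
  inhabited (steps (stack (Mul P Q) l) (stack (append P Q) l)).
Proof.
elim: Q P l => [i|B IHB D IHD] P l h; first by constructor; apply: Defs.Nil.
have [p] := stack_step h.
have h' := (step_expression p).2.
have [q] := IHB P (D :: l) h'.
have [|r] := IHD (append P B) l.
  by rewrite /is_expression -h' !vars_stack /= vars_append.
by constructor; apply: Defs.Cons p (steps_cat q r).
Qed.

Lemma stack_normal P l : is_expression (stack P l) ->
  inhabited (steps (stack P l) (stack (normal P) l)).
Proof.
elim: P l => [i|P IHP Q _] l h; first by constructor; apply: Defs.Nil.
have [p] := IHP (Q :: l) h.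
have [|q] := @stack_append (normal P) Q l.
  by rewrite /is_expression -h !vars_stack /= vars_normal.
by constructor; apply: steps_cat p q.
Qed.

Lemma steps_exist E F :
  is_expression E -> is_expression F -> inhabited (steps E F).
Proof.
move=> hE hF.
have [p] := @stack_normal E [::] hE; have [q] := @stack_normal F [::] hF.
constructor; apply: steps_cat p _.
by rewrite (@normal_vars _ E F) ?hE //; apply: steps_rev.
Qed.

End Paths.

Theorem theorem1 (C : category) (mul : functor (prod_cat C C) C)
    (alpha : natiso (word_functor mul assoc_src) (word_functor mul assoc_tgt))
    (n : nat) (E F : word 'I_n)
    (hE : is_expression E) (hF : is_expression F) :
  exists! eta : natiso (word_functor mul E) (word_functor mul F),
    exists p : steps E F, composite alpha p = eta.
Proof.
have [p] := steps_exist hE hF.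
exists (composite alpha p); split; first by exists p.
by move=> _ [q <-]; apply: composite_unique.
Qed.
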